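(* Let $V$ and $W$ be two diffeological vector spaces, let $B^{\infty}(V,W)$ be the space of all smooth bilinear maps $V\times V\to W$ considered with the functional diffeology, and let $L^{\infty}(V,L^{\infty}(V,W))$ be the space of all smooth linear maps $V\to L^{\infty}(V,W)$, also endowed with the functional diffeology (where $L^{\infty}(V,W)$ itself carries the functional diffeology). Then $B^{\infty}(V,W)$ and $L^{\infty}(V,L^{\infty}(V,W))$ are diffeomorphic as diffeological vector spaces, i.e., there is a linear bijection between them that is smooth and has smooth inverse.
   Context: A diffeological space is a set $X$ with a collection of maps (plots) $U\to X$, for $U$ open in $\mathbb{R}^n$, $n\in\mathbb{N}$, such that: constant maps are plots; the composition of a plot with an ordinary smooth map between open sets of Euclidean spaces is a plot; a map that is locally a plot is a plot. A map $f:X\to Y$ of diffeological spaces is smooth if $f\circ p$ is a plot of $Y$ for every plot $p$ of $X$; a diffeomorphism is a smooth bijection with smooth inverse. $C^\infty(X,Y)$ is the set of smooth maps. One diffeology is coarser than another if it contains it. The product diffeology on $X\times Y$ is the coarsest one making both projections smooth. The functional diffeology on $C^\infty(X,Y)$ is the coarsest one making the evaluation map $C^\infty(X,Y)\times X\to Y$, $(f,x)\mapsto f(x)$, smooth (equivalently, $p:U\to C^\infty(X,Y)$ is a plot iff $(u,x)\mapsto p(u)(x)$ is smooth on $U\times X$); subsets of $C^\infty(X,Y)$ carry the induced subset diffeology, also called functional. A diffeological vector space is a real vector space with a diffeology for which addition $V\times V\to V$ and scalar multiplication $\mathbb{R}\times V\to V$ are smooth ($\mathbb{R}$ has its standard diffeology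 of ordinary smooth maps). $L^\infty(V,W)$ is the space of smooth linear maps $V\to W$. Bilinear maps $V\times V\to W$ are considered smooth with respect to the product diffeology on $V\times V$. *)

(* Defs.v *)
From HB Require Import structures.
From mathcomp Require Import all_boot all_order all_algebra sesquilinear.
From mathcomp Require Import boolp classical_sets functions reals topology.
From mathcomp Require Import normedtype landau derive.
Set Implicit Arguments.
Unset Strict Implicit.
Unset Printing Implicit Defensive.
Import Order.TTheory GRing.Theory Num.Theory.
Import numFieldNormedType.Exports.
Local Open Scope classical_set_scope.
Local Open Scope ring_scope.

(* C^k on an open subset U of R^n: f is k times (Frechet) differentiable at    *)
(* every point of U, and all its iterated directional derivatives of order at *)
(* most k are continuous on U. The values of f outside U do not matter, see    *)
(* eq_Ck_on.                                                                  *)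
Fixpoint Ck_on (R : realType) (n : nat) (E : normedModType R) (k : nat)
    (U : set 'rV[R]_n) (f : 'rV[R]_n -> E) : Prop :=
  match k with
  | 0 => forall x, U x -> {for x, continuous f}
  | k'.+1 => (forall x, U x -> differentiable f x) /\
             (forall v, Ck_on k' U (fun x => 'D_v f x))
  end.

Definition smooth_on (R : realType) (n : nat) (E : normedModType R)
    (U : set 'rV[R]_n) (f : 'rV[R]_n -> E) : Prop :=
  forall k, Ck_on k U f.

Section SmoothOn.
Variable R : realType.

Lemma near0_differentiable (V E : normedModType R) (h : V -> E) (x : V) :
  (\forall y \near x, h y = 0) -> differentiable h x.
Proof.
move=> h0.
have H : continuous (0 : V -> E) /\ h \o shift x = cst (h x) + (0 : V -> E) +o_ 0 id.
  split; first exact: cst_continuous.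
  have -> : cst (h x) + (0 : V -> E) = 0.
    by rewrite (nbhs_singleton h0); apply/funext => y; rewrite !fctE addr0.
  apply/eqaddoP => e e0; rewrite subr0.
  move: h0; rewrite (near_shift 0) subr0; apply: filterS => y /= ->.
  by rewrite normr0 mulr_ge0// ltW.
apply/diff_locallyP.
have -> : ('d h x : V -> E) = (0 : V -> E) by exact: diff_unique H.1 H.2.
exact: H.
Qed.

Lemma near_eq_differentiable (V E : normedModType R) (f g : V -> E) (x : V) :
  (\forall y \near x, f y = g y) -> differentiable f x -> differentiable g x.
Proof.
move=> fg df; rewrite -[g](subrKC f); apply: differentiableD => //.
apply: near0_differentiable; apply: filterS fg => y yE.
by rewrite !fctE yE subrr.
Qed.

Variable n : nat.
Implicit Types (E : normedModType R) (U : set 'rV[R]_n).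

Lemma open_near U (P : 'rV[R]_n -> Prop) x : open U -> U x ->
  (forall y, U y -> P y) -> \forall y \near x, P y.
Proof. by move=> oU Ux UP; apply: filterS UP _; exact: open_nbhs_nbhs. Qed.

Lemma eq_Ck_on E k U (f g : 'rV[R]_n -> E) : open U ->
  (forall x, U x -> f x = g x) -> Ck_on k U f -> Ck_on k U g.
Proof.
move=> oU; elim: k f g => [|k IH] f g fg /=.
  move=> Cf x Ux; rewrite /prop_for /continuous_at -fg//.
  by apply: cvg_trans (Cf x Ux); apply: (@near_eq_cvg _ _ (nbhs x)); apply: (open_near oU Ux).
move=> [df Cf]; split => [x Ux|v].
  by apply: near_eq_differentiable (df x Ux); apply: (open_near oU Ux).
apply: IH (Cf v) => x Ux; by apply: near_eq_derive; apply: (open_near oU Ux).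
Qed.

Lemma Ck_on_local E k U (f : 'rV[R]_n -> E) :
  (forall x, U x -> exists V, [/\ V x, V `<=` U & Ck_on k V f]) -> Ck_on k U f.
Proof.
elim: k f => [|k IH] f Hf /=.
  by move=> x /Hf[V [Vx _ CV]]; exact: CV.
split=> [x /Hf[V [Vx _ [dV _]]]|v]; first exact: dV.
by apply: IH => x /Hf[V [Vx VU [_ Cf]]]; exists V; split=> //; exact: Cf.
Qed.

Lemma Ck_onS E k U (f : 'rV[R]_n -> E) : Ck_on k.+1 U f -> Ck_on k U f.
Proof.
elim: k f => [|k IH] f [df Cf].
  by move=> x Ux; apply: differentiable_continuous; exact: df.
by split=> // v; apply: IH; exact: Cf.
Qed.

Lemma Ck_on_cst E k U (c : E) : Ck_on k U (fun _ : 'rV[R]_n => c).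
Proof.
elim: k c => [|k IH] c /=; first by move=> x _; exact: cst_continuous.
split=> [x _|v]; first exact: differentiable_cst.
have -> : (fun x => 'D_v (fun=> c) x) = (fun=> 0) :> ('rV[R]_n -> E).
  by apply/funext => x; exact: derive_cst.
exact: IH.
Qed.

Lemma Ck_onD E k U (f g : 'rV[R]_n -> E) : open U ->
  Ck_on k U f -> Ck_on k U g -> Ck_on k U (fun x => f x + g x).
Proof.
move=> oU; elim: k f g => [|k IH] f g /=.
  by move=> Cf Cg x Ux; apply: continuousD; [exact: Cf|exact: Cg].
move=> [df Cf] [dg Cg]; split=> [x Ux|v].
  by apply: differentiableD; [exact: df|exact: dg].
apply: eq_Ck_on (IH _ _ (Cf v) (Cg v)) => // x Ux.
by rewrite -deriveD//; apply: diff_derivable; [exact: df|exact: dg].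
Qed.

Lemma Ck_on_sum E k U (I : Type) (s : seq I) (f : I -> 'rV[R]_n -> E) :
  open U -> (forall i, Ck_on k U (f i)) ->
  Ck_on k U (fun x => \sum_(i <- s) f i x).
Proof.
move=> oU Cf; elim: s => [|i s IH].
  apply: eq_Ck_on (Ck_on_cst _ _ 0) => // x _; by rewrite big_nil.
apply: eq_Ck_on (Ck_onD oU (Cf i) IH) => // x _; by rewrite big_cons.
Qed.

Lemma scale_bilinear E : bilinear_for
    (GRing.Scale.Law.clone _ _ *:%R _) (GRing.Scale.Law.clone _ _ *:%R _)
    (fun (a : R^o) (w : E) => a *: w).
Proof.
split=> [w|a] c x y /=; first by rewrite scalerDl scalerA.
by rewrite scalerDr !scalerA mulrC.
Qed.

Lemma is_diff_scalev E (a : 'rV[R]_n -> R^o) (w : 'rV[R]_n -> E) x :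
  differentiable a x -> differentiable w x ->
  is_diff x (fun y => a y *: w y) (fun v => a x *: 'd w x v + 'd a x v *: w x).
Proof.
move=> da dw.
pose bM := bilinear_isBilinear.Build R R^o E E _ _ _ (@scale_bilinear E).
pose b : {bilinear R^o -> E -> E} := HB.pack (fun (a : R^o) (w : E) => a *: w) bM.
have bc : continuous (fun p : R^o * E => b p.1 p.2) by exact: scale_continuous.
have db : differentiable (fun p : R^o * E => b p.1 p.2) (a x, w x).
  exact: differentiable_bilin.
have dp : differentiable (fun y => (a y, w y)) x by exact: differentiable_pair.
apply: DiffDef; first exact: (differentiable_comp dp db).
have -> : (fun y => a y *: w y) =
  (fun p : R^o * E => b p.1 p.2) \o (fun y => (a y, w y)) by [].
rewrite diff_comp// (diff_bilin _ bc) diff_pair//.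
Qed.

Lemma Ck_on_scale E k U (a : 'rV[R]_n -> R^o) (w : 'rV[R]_n -> E) : open U ->
  Ck_on k U a -> Ck_on k U w -> Ck_on k U (fun x => a x *: w x).
Proof.
move=> oU; elim: k a w => [|k IH] a w.
  by move=> Ca Cw x Ux; apply: continuousZ; [exact: Ca|exact: Cw].
move=> Ha Hw; have [da Ca] := Ha; have [dw Cw] := Hw; split=> [x Ux|v].
  by have := is_diff_scalev (da x Ux) (dw x Ux) => -[].
apply: eq_Ck_on (Ck_onD oU (IH _ _ (Ck_onS Ha) (Cw v))
  (IH _ _ (Ca v) (Ck_onS Hw))) => // x Ux.
have [d dE] := is_diff_scalev (da x Ux) (dw x Ux).
rewrite [RHS]deriveE// dE !deriveE//; [exact: da|exact: dw].
Qed.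

Lemma Ck_on_coord k U m (f : 'rV[R]_n -> 'rV[R]_m) j : open U ->
  Ck_on k U f -> Ck_on k U (fun x => f x ord0 j : R^o).
Proof.
move=> oU; elim: k f => [|k IH] f.
  move=> Cf x Ux; apply: (@continuous_comp _ _ _ f (fun M : 'rV[R]_m => M ord0 j : R^o)).
    exact: Cf.
  exact: coord_continuous.
move=> [df Cf]; split=> [x Ux|v].
  apply: (differentiable_comp (g := fun M : 'rV[R]_m => M ord0 j : R^o)).
    exact: df.
  exact: differentiable_coord.
apply: eq_Ck_on (IH _ (Cf v)) => // x Ux.
rewrite derive_mx ?mxE//; exact/diff_derivable/df.
Qed.

End SmoothOn.

Section SmoothComp.
Variables (R : realType) (m n : nat) (E : normedModType R).

Lemma Ck_on_comp k (U : set 'rV[R]_m) (V : set 'rV[R]_n)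
    (f : 'rV[R]_m -> 'rV[R]_n) (g : 'rV[R]_n -> E) :
  open U -> (forall x, U x -> V (f x)) ->
  Ck_on k U f -> Ck_on k V g -> Ck_on k U (g \o f).
Proof.
move=> oU UV; elim: k g => [|k IH] g.
  by move=> Cf Cg x Ux; apply: continuous_comp; [exact: Cf|exact/Cg/UV].
move=> Hf [dg Cg]; have [df Cf] := Hf; split=> [x Ux|v].
  by apply: differentiable_comp; [exact: df|exact/dg/UV].
have Cgj j : Ck_on k U ((fun y => 'D_('e_j) g y) \o f).
  by apply: IH (Cg _); exact: Ck_onS.
have Cfj j := Ck_on_coord j oU (Cf v).
apply: eq_Ck_on (Ck_on_sum (index_enum 'I_n) oU
  (fun j => Ck_on_scale oU (Cfj j) (Cgj j))) => // x Ux.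
have [dfx dgx] := (df x Ux, dg _ (UV x Ux)).
rewrite [RHS]deriveE; last exact: differentiable_comp.
rewrite diff_comp//= -(deriveE _ dfx) [in RHS](row_sum_delta ('D_v f x)) linear_sum.
by apply: eq_bigr => j _; rewrite linearZ /=; congr (_ *: _); exact: deriveE.
Qed.

Lemma smooth_on_comp (U : set 'rV[R]_m) (V : set 'rV[R]_n)
    (f : 'rV[R]_m -> 'rV[R]_n) (g : 'rV[R]_n -> E) :
  open U -> (forall x, U x -> V (f x)) ->
  smooth_on U f -> smooth_on V g -> smooth_on U (g \o f).
Proof. by move=> oU UV Cf Cg k; exact: Ck_on_comp (Cf k) (Cg k). Qed.

End SmoothComp.

(* A plot U -> X is represented by a total function R^n -> X considered only  *)
(* on the open set U: by plot_ext its values outside U are irrelevant.        *)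
HB.mixin Record isDiffeological (R : realType) (X : Type) := {
  plot : forall n : nat, set 'rV[R]_n -> ('rV[R]_n -> X) -> Prop;
  plot_open : forall n (U : set 'rV[R]_n) (p : 'rV[R]_n -> X),
    plot n U p -> open U;
  plot_ext : forall n (U : set 'rV[R]_n) (p q : 'rV[R]_n -> X),
    (forall u, U u -> p u = q u) -> plot n U p -> plot n U q;
  plot_cst : forall n (U : set 'rV[R]_n) (x : X),
    open U -> plot n U (fun=> x);
  plot_comp : forall m n (U : set 'rV[R]_m) (V : set 'rV[R]_n)
      (f : 'rV[R]_m -> 'rV[R]_n) (p : 'rV[R]_n -> X),
    open U -> smooth_on U f -> (forall u, U u -> V (f u)) ->
    plot n V p -> plot m U (fun u => p (f u));
  plot_local : forall n (U : set 'rV[R]_n) (p : 'rV[R]_n -> X),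
    open U ->
    (forall u, U u ->
       exists V : set 'rV[R]_n, [/\ V u, V `<=` U & plot n V p]) ->
    plot n U p
}.

#[short(type="diffeologicalType")]
HB.structure Definition Diffeological (R : realType) :=
  {X of isDiffeological R X}.

Arguments plot {R X n} U p : rename.
Arguments plot_open {R X n U p} : rename.
Arguments plot_ext {R X n U p q} : rename.
Arguments plot_cst {R X n U} x : rename.
Arguments plot_comp {R X m n U V f p} : rename.
Arguments plot_local {R X n U p} : rename.

Definition smooth (R : realType) (X Y : diffeologicalType R) (f : X -> Y) :=
  forall n (U : set 'rV[R]_n) (p : 'rV[R]_n -> X),
    plot U p -> plot U (fun u => f (p u)).

Section BasicSmooth.
Variable R : realType.
Implicit Types X Y Z : diffeologicalType R.

Lemma smooth_comp X Y Z (f : X -> Y) (g : Y -> Z) :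
  smooth f -> smooth g -> smooth (fun x => g (f x)).
Proof. by move=> sf sg n U p /sf/sg. Qed.

Lemma smooth_cst X Y (y : Y) : smooth (fun _ : X => y).
Proof. by move=> n U p /plot_open oU; exact: plot_cst. Qed.

Lemma smooth_onid n (U : set 'rV[R]_n) : smooth_on U id.
Proof.
case=> [|k]; first by move=> x _; exact: cvg_id.
split=> [x _|v]; first exact: ex_diff.
have -> : (fun x => 'D_v id x) = (fun=> v) :> ('rV[R]_n -> 'rV[R]_n).
  by apply/funext => x; exact: derive_id.
exact: Ck_on_cst.
Qed.

Lemma smooth_on_subset n (E : normedModType R) (U V : set 'rV[R]_n)
  (f : 'rV[R]_n -> E) : open V -> V `<=` U -> smooth_on U f -> smooth_on V f.
Proof. by move=> oV VU sf; apply: smooth_on_comp sf => //; exact: smooth_onid. Qed.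

Lemma plot_subset X n (U V : set 'rV[R]_n) (p : 'rV[R]_n -> X) :
  open V -> V `<=` U -> plot U p -> plot V p.
Proof. by move=> oV VU; exact: plot_comp oV (@smooth_onid n V) VU. Qed.

End BasicSmooth.

Section RealLine.
Variable R : realType.

Definition real_plot n (U : set 'rV[R]_n) (p : 'rV[R]_n -> R^o) :=
  open U /\ smooth_on U p.

Fact real_plot_open n (U : set 'rV[R]_n) p : real_plot U p -> open U.
Proof. by case. Qed.

Fact real_plot_ext n (U : set 'rV[R]_n) (p q : 'rV[R]_n -> R^o) :
  (forall u, U u -> p u = q u) -> real_plot U p -> real_plot U q.
Proof. by move=> pq [oU sp]; split=> // k; exact: eq_Ck_on (sp k). Qed.

Fact real_plot_cst n (U : set 'rV[R]_n) (x : R^o) :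
  open U -> real_plot U (fun=> x).
Proof. by move=> oU; split=> // k; exact: Ck_on_cst. Qed.

Fact real_plot_comp m n (U : set 'rV[R]_m) (V : set 'rV[R]_n)
    (f : 'rV[R]_m -> 'rV[R]_n) (p : 'rV[R]_n -> R^o) :
  open U -> smooth_on U f -> (forall u, U u -> V (f u)) ->
  real_plot V p -> real_plot U (fun u => p (f u)).
Proof. by move=> oU sf UV [_ sp]; split=> //; exact: smooth_on_comp sf sp. Qed.

Fact real_plot_local n (U : set 'rV[R]_n) (p : 'rV[R]_n -> R^o) : open U ->
  (forall u, U u -> exists V, [/\ V u, V `<=` U & real_plot V p]) ->
  real_plot U p.
Proof.
move=> oU H; split=> // k; apply: Ck_on_local => u /H[V [Vu VU [_ sp]]].
by exists V; split.
Qed.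

HB.instance Definition _ := isDiffeological.Build R R^o real_plot_open
  real_plot_ext real_plot_cst real_plot_comp real_plot_local.

End RealLine.

(* The diffeology on S induced by j : S -> X; it is only used when j is the   *)
(* inclusion of a subset of X.                                                *)
Section SubsetDiffeology.
Variables (R : realType) (X : diffeologicalType R) (S : Type) (j : S -> X).

Definition sub_plot n (U : set 'rV[R]_n) (p : 'rV[R]_n -> S) :=
  plot U (fun u => j (p u)).

Fact sub_plot_open n (U : set 'rV[R]_n) p : sub_plot U p -> open U.
Proof. exact: plot_open. Qed.

Fact sub_plot_ext n (U : set 'rV[R]_n) (p q : 'rV[R]_n -> S) :
  (forall u, U u -> p u = q u) -> sub_plot U p -> sub_plot U q.
Proof. by move=> pq; apply: plot_ext => u /pq ->. Qed.

Fact sub_plot_cst n (U : set 'rV[R]_n) (x : S) :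
  open U -> sub_plot U (fun=> x).
Proof. exact: plot_cst. Qed.

Fact sub_plot_comp m n (U : set 'rV[R]_m) (V : set 'rV[R]_n)
    (f : 'rV[R]_m -> 'rV[R]_n) (p : 'rV[R]_n -> S) :
  open U -> smooth_on U f -> (forall u, U u -> V (f u)) ->
  sub_plot V p -> sub_plot U (fun u => p (f u)).
Proof. exact: plot_comp. Qed.

Fact sub_plot_local n (U : set 'rV[R]_n) (p : 'rV[R]_n -> S) : open U ->
  (forall u, U u -> exists V, [/\ V u, V `<=` U & sub_plot V p]) ->
  sub_plot U p.
Proof. exact: plot_local. Qed.

Definition sub_diffeology := isDiffeological.Build R S sub_plot_open
  sub_plot_ext sub_plot_cst sub_plot_comp sub_plot_local.

End SubsetDiffeology.

Section ProductDiffeology.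
Variables (R : realType) (X Y : diffeologicalType R).

Definition prod_plot n (U : set 'rV[R]_n) (p : 'rV[R]_n -> X * Y) :=
  plot U (fun u => (p u).1) /\ plot U (fun u => (p u).2).

Fact prod_plot_open n (U : set 'rV[R]_n) p : prod_plot U p -> open U.
Proof. by case=> /plot_open. Qed.

Fact prod_plot_ext n (U : set 'rV[R]_n) (p q : 'rV[R]_n -> X * Y) :
  (forall u, U u -> p u = q u) -> prod_plot U p -> prod_plot U q.
Proof.
move=> pq [p1 p2].
by split; [apply: plot_ext p1|apply: plot_ext p2] => u /pq ->.
Qed.

Fact prod_plot_cst n (U : set 'rV[R]_n) (x : X * Y) :
  open U -> prod_plot U (fun=> x).
Proof. by move=> oU; split; exact: plot_cst. Qed.

Fact prod_plot_comp m n (U : set 'rV[R]_m) (V : set 'rV[R]_n)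
    (f : 'rV[R]_m -> 'rV[R]_n) (p : 'rV[R]_n -> X * Y) :
  open U -> smooth_on U f -> (forall u, U u -> V (f u)) ->
  prod_plot V p -> prod_plot U (fun u => p (f u)).
Proof.
by move=> oU sf UV [p1 p2]; split;
  [exact: (plot_comp oU sf UV p1)|exact: (plot_comp oU sf UV p2)].
Qed.

Fact prod_plot_local n (U : set 'rV[R]_n) (p : 'rV[R]_n -> X * Y) : open U ->
  (forall u, U u -> exists V, [/\ V u, V `<=` U & prod_plot V p]) ->
  prod_plot U p.
Proof.
move=> oU H; split; apply: plot_local => // u /H[V [Vu VU [p1 p2]]];
  by exists V; split.
Qed.

HB.instance Definition _ := isDiffeological.Build R (X * Y)%type prod_plot_open
  prod_plot_ext prod_plot_cst prod_plot_comp prod_plot_local.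

Lemma fst_smooth : smooth (fst : X * Y -> X).
Proof. by move=> n U p []. Qed.

Lemma snd_smooth : smooth (snd : X * Y -> Y).
Proof. by move=> n U p []. Qed.

(* For Z the set X * Y with an arbitrary diffeology and i the identity, this  *)
(* says that the diffeology above is the coarsest one making the projections  *)
(* smooth.                                                                    *)
Lemma prod_diffeology_coarsest (Z : diffeologicalType R) (i : Z -> X * Y) :
  smooth (fun z => (i z).1) -> smooth (fun z => (i z).2) -> smooth i.
Proof. by move=> s1 s2 n U p pp; split; [exact: s1|exact: s2]. Qed.

End ProductDiffeology.

Definition smooth_pred (R : realType) (X Y : diffeologicalType R) :
  pred (X -> Y) := fun f => `[< smooth f >].

Record Cinf (R : realType) (X Y : diffeologicalType R) := MkCinf {
  Cinf_fun :> X -> Y;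
  Cinf_prop : smooth_pred Cinf_fun
}.

HB.instance Definition _ (R : realType) (X Y : diffeologicalType R) :=
  [isSub for @Cinf_fun R X Y].
HB.instance Definition _ (R : realType) (X Y : diffeologicalType R) :=
  gen_eqMixin (Cinf X Y).
HB.instance Definition _ (R : realType) (X Y : diffeologicalType R) :=
  gen_choiceMixin (Cinf X Y).

Section FunctionalDiffeology.
Variables (R : realType) (X Y : diffeologicalType R).

Lemma CinfP (f : Cinf X Y) : smooth f.
Proof. by apply/asboolP; exact: Cinf_prop. Qed.

(* p is a plot iff (u, x) |-> p u x is smooth on U * X, where U has the subset *)
(* diffeology of R^n: (f, q) below is an arbitrary plot of U * X.             *)
Definition fun_plot n (U : set 'rV[R]_n) (p : 'rV[R]_n -> Cinf X Y) :=
  open U /\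
  forall m (V : set 'rV[R]_m) (f : 'rV[R]_m -> 'rV[R]_n) (q : 'rV[R]_m -> X),
    smooth_on V f -> (forall v, V v -> U (f v)) -> plot V q ->
    plot V (fun v => p (f v) (q v)).

Fact fun_plot_open n (U : set 'rV[R]_n) p : fun_plot U p -> open U.
Proof. by case. Qed.

Fact fun_plot_ext n (U : set 'rV[R]_n) (p q : 'rV[R]_n -> Cinf X Y) :
  (forall u, U u -> p u = q u) -> fun_plot U p -> fun_plot U q.
Proof.
move=> pq [oU pp]; split=> // m V f r sf VU pr.
by apply: plot_ext (pp _ _ _ _ sf VU pr) => v /VU/pq ->.
Qed.

Fact fun_plot_cst n (U : set 'rV[R]_n) (g : Cinf X Y) :
  open U -> fun_plot U (fun=> g).
Proof. by move=> oU; split=> // m V f r _ _ /(CinfP g). Qed.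

Fact fun_plot_comp m n (U : set 'rV[R]_m) (V : set 'rV[R]_n)
    (f : 'rV[R]_m -> 'rV[R]_n) (p : 'rV[R]_n -> Cinf X Y) :
  open U -> smooth_on U f -> (forall u, U u -> V (f u)) ->
  fun_plot V p -> fun_plot U (fun u => p (f u)).
Proof.
move=> oU sf UV [_ pp]; split=> // k W g r sg WU pr.
apply: (pp _ _ (fun w => f (g w))) => //; last by move=> w /WU/UV.
exact: smooth_on_comp (plot_open pr) WU sg sf.
Qed.

Fact fun_plot_local n (U : set 'rV[R]_n) (p : 'rV[R]_n -> Cinf X Y) : open U ->
  (forall u, U u -> exists V, [/\ V u, V `<=` U & fun_plot V p]) ->
  fun_plot U p.
Proof.
move=> oU H; split=> // m W f q sf WU pq; have oW := plot_open pq.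
apply: plot_local => // w Ww; have [V [Vf VU [oV pV]]] := H _ (WU w Ww).
have oW' : open (W `&` f @^-1` V).
  rewrite openE => z [Wz Vz]; apply: filterI; first exact: open_nbhs_nbhs.
  by apply: (sf 0%N z Wz); exact: open_nbhs_nbhs.
exists (W `&` f @^-1` V); split=> //.
apply: pV; last exact: plot_subset pq.
- by apply: smooth_on_subset sf.
- by move=> ? [].
Qed.

HB.instance Definition _ := isDiffeological.Build R (Cinf X Y) fun_plot_open
  fun_plot_ext fun_plot_cst fun_plot_comp fun_plot_local.

Lemma eval_smooth : smooth (fun z : Cinf X Y * X => z.1 z.2).
Proof.
by move=> n U p [[oU pp] pq]; apply: (pp _ _ id) => //; exact: smooth_onid.
Qed.

(* For T the set Cinf X Y with an arbitrary diffeology and i the identity,    *)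
(* this says that the diffeology above is the coarsest one making the         *)
(* evaluation map smooth.                                                     *)
Lemma functional_diffeology_coarsest (T : diffeologicalType R)
    (i : T -> Cinf X Y) :
  smooth (fun z : T * X => i z.1 z.2) -> smooth i.
Proof.
move=> si n U p pp; split; first exact: plot_open pp.
move=> m V f q sf VU pq; apply: (si _ _ (fun v => (p (f v), q v))); split=> //=.
exact: plot_comp (plot_open pq) sf VU pp.
Qed.

End FunctionalDiffeology.

HB.mixin Record isDiffVect (R : realType) V
    of GRing.Lmodule R V & Diffeological R V := {
  addv_smooth : smooth (fun z : V * V => z.1 + z.2);
  scalev_smooth : smooth (fun z : R^o * V => (z.1 : R) *: z.2)
}.

#[short(type="diffVectType")]
HB.structure Definition DiffVect (R : realType) :=
  {V of isDiffVect R V & GRing.Lmodule R V & Diffeological R V}.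

Section DiffVectOps.
Variables (R : realType) (X : diffeologicalType R) (W : diffVectType R).

Lemma smoothD (f g : X -> W) : smooth f -> smooth g -> smooth (f + g).
Proof.
move=> sf sg n U p pp; apply: (addv_smooth _ _ (fun u => (f (p u), g (p u)))).
by split; [exact: sf|exact: sg].
Qed.

Lemma smoothZ (a : R) (f : X -> W) : smooth f -> smooth (a *: f).
Proof.
move=> sf n U p pp.
apply: (scalev_smooth _ _ (fun u => (a : R^o, f (p u)))).
split; last exact: sf.
exact: plot_cst (plot_open pp).
Qed.

Fact smooth_submod_closed : submod_closed (@smooth_pred R X W).
Proof.
split=> [|a f g]; first by apply/asboolP; exact: smooth_cst.
move=> /asboolP sf /asboolP sg; apply/asboolP.
by apply: smoothD => //; exact: smoothZ.
Qed.

HB.instance Definition _ := GRing.isSubmodClosed.Build R (X -> W)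
  (@smooth_pred R X W) smooth_submod_closed.

HB.instance Definition _ := [SubChoice_isSubLmodule of Cinf X W by <:].

Lemma CinfDE (f g : Cinf X W) x : (f + g) x = f x + g x.
Proof. by []. Qed.

Lemma CinfZE (a : R) (f : Cinf X W) x : (a *: f) x = a *: f x.
Proof. by []. Qed.

Fact Cinf_addv_smooth : smooth (fun z : Cinf X W * Cinf X W => z.1 + z.2).
Proof.
move=> n U p [[oU p1] [_ p2]]; split=> // m V f q sf VU pq.
apply: (addv_smooth _ _ (fun v => ((p (f v)).1 (q v), (p (f v)).2 (q v)))).
by split; [exact: p1|exact: p2].
Qed.

Fact Cinf_scalev_smooth :
  smooth (fun z : R^o * Cinf X W => (z.1 : R) *: z.2).
Proof.
move=> n U p [p1 [oU p2]]; split=> // m V f q sf VU pq.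
apply: (scalev_smooth _ _ (fun v => ((p (f v)).1, (p (f v)).2 (q v)))).
split; last exact: p2.
exact: plot_comp (plot_open pq) sf VU p1.
Qed.

HB.instance Definition _ :=
  isDiffVect.Build R (Cinf X W) Cinf_addv_smooth Cinf_scalev_smooth.

End DiffVectOps.

Definition linear_pred (R : realType) (V W : diffVectType R) :
  pred (Cinf V W) := fun f => `[< linear f >].

Definition bilinear_pred (R : realType) (V W : diffVectType R) :
  pred (Cinf (V * V)%type W) :=
  fun f => `[< bilinear_for *:%R *:%R (fun x y => f (x, y)) >].

Record Linf (R : realType) (V W : diffVectType R) := MkLinf {
  Linf_fun :> Cinf V W;
  Linf_prop : linear_pred Linf_fun
}.

Record Binf (R : realType) (V W : diffVectType R) := MkBinf {
  Binf_fun :> Cinf (V * V)%type W;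
  Binf_prop : bilinear_pred Binf_fun
}.

Section Linf.
Variables (R : realType) (V W : diffVectType R).

HB.instance Definition _ := [isSub for @Linf_fun R V W].
HB.instance Definition _ := gen_eqMixin (Linf V W).
HB.instance Definition _ := gen_choiceMixin (Linf V W).
HB.instance Definition _ := sub_diffeology (@Linf_fun R V W).

Fact linear_submod_closed : submod_closed (@linear_pred R V W).
Proof.
split=> [|a f g]; first by apply/asboolP => b x y; rewrite /= scaler0 addr0.
move=> /asboolP lf /asboolP lg; apply/asboolP => b x y.
rewrite !CinfDE !CinfZE lf lg !scalerDr !scalerA (mulrC a b).
by rewrite addrACA.
Qed.

HB.instance Definition _ := GRing.isSubmodClosed.Build R (Cinf V W)
  (@linear_pred R V W) linear_submod_closed.
HB.instance Definition _ := [SubChoice_isSubLmodule of Linf V W by <:].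

Fact Linf_addv_smooth : smooth (fun z : Linf V W * Linf V W => z.1 + z.2).
Proof.
move=> n U p [p1 p2].
by apply: (addv_smooth _ _ (fun u => ((p u).1 : Cinf V W, (p u).2 : Cinf V W))).
Qed.

Fact Linf_scalev_smooth : smooth (fun z : R^o * Linf V W => (z.1 : R) *: z.2).
Proof.
move=> n U p [p1 p2].
by apply: (scalev_smooth _ _ (fun u => ((p u).1, (p u).2 : Cinf V W))).
Qed.

HB.instance Definition _ :=
  isDiffVect.Build R (Linf V W) Linf_addv_smooth Linf_scalev_smooth.

End Linf.

Section Binf.
Variables (R : realType) (V W : diffVectType R).

HB.instance Definition _ := [isSub for @Binf_fun R V W].
HB.instance Definition _ := gen_eqMixin (Binf V W).
HB.instance Definition _ := gen_choiceMixin (Binf V W).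
HB.instance Definition _ := sub_diffeology (@Binf_fun R V W).

Fact bilinear_submod_closed : submod_closed (@bilinear_pred R V W).
Proof.
split=> [|a f g].
  by apply/asboolP; split=> u b x y; rewrite /= scaler0 addr0.
move=> /asboolP[f1 f2] /asboolP[g1 g2]; apply/asboolP.
split=> u b x y; rewrite !CinfDE !CinfZE.
  rewrite (f1 u b) (g1 u b) /= !scalerDr !scalerA (mulrC a b).
  by rewrite addrACA.
rewrite (f2 u b) (g2 u b) /= !scalerDr !scalerA (mulrC a b).
by rewrite addrACA.
Qed.

HB.instance Definition _ := GRing.isSubmodClosed.Build R (Cinf (V * V)%type W)
  (@bilinear_pred R V W) bilinear_submod_closed.
HB.instance Definition _ := [SubChoice_isSubLmodule of Binf V W by <:].

Fact Binf_addv_smooth : smooth (fun z : Binf V W * Binf V W => z.1 + z.2).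
Proof.
move=> n U p [p1 p2]; apply: (addv_smooth _ _
  (fun u => ((p u).1 : Cinf (V * V)%type W, (p u).2 : Cinf (V * V)%type W))).
by [].
Qed.

Fact Binf_scalev_smooth : smooth (fun z : R^o * Binf V W => (z.1 : R) *: z.2).
Proof.
move=> n U p [p1 p2]; apply: (scalev_smooth _ _
  (fun u => ((p u).1, (p u).2 : Cinf (V * V)%type W))).
by [].
Qed.

HB.instance Definition _ :=
  isDiffVect.Build R (Binf V W) Binf_addv_smooth Binf_scalev_smooth.

End Binf.

Definition diffvect_diffeomorphic (R : realType) (V W : diffVectType R) :=
  exists (phi : V -> W) (psi : W -> V),
    [/\ linear phi, cancel phi psi, cancel psi phi, smooth phi & smooth psi].

(* Main.v *)
Require Import Defs.
From mathcomp Require Import all_boot all_order all_algebra reals.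
From mathcomp Require Import boolp.
Set Implicit Arguments.
Unset Strict Implicit.
Unset Printing Implicit Defensive.
Local Open Scope ring_scope.

(** Currying. Each functional diffeology satisfies the exponential law: a map
    [T -> C^oo(X, Y)] is smooth iff the uncurried map [T * X -> Y] is, and this
    passes to the subspaces of linear and of bilinear maps. So the smoothness of
    both directions, as well as the smoothness of every map they produce,
    reduces to the smoothness of evaluation maps. *)

Section ExponentialLaw.
Variables (R : realType) (T : diffeologicalType R) (V W : diffVectType R).

(** Plots of [Linf V W] are by definition plots of [Cinf V W] after inclusion, so the coarsest
    property of the functional diffeology transfers unchanged. *)
Lemma Linf_smooth (i : T -> Linf V W) :
  smooth (fun z : T * V => i z.1 z.2) -> smooth i.
Proof.
exact: (@functional_diffeology_coarsest R V W T (fun t => i t : Cinf V W)).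
Qed.

Lemma Binf_smooth (i : T -> Binf V W) :
  smooth (fun z : T * (V * V) => i z.1 z.2) -> smooth i.
Proof.
exact: (@functional_diffeology_coarsest R (V * V)%type W T
  (fun t => i t : Cinf (V * V)%type W)).
Qed.

(** Evaluation composed with the pairing of [f] and [x]: function and argument may both vary with
    the parameter. *)
Lemma smooth_Linf_app (f : T -> Linf V W) (x : T -> V) :
  smooth f -> smooth x -> smooth (fun t => f t (x t)).
Proof.
move=> sf sx n U p pp.
apply: (@eval_smooth R V W _ _ (fun u => (f (p u) : Cinf V W, x (p u)))).
by split; [exact: sf|exact: sx].
Qed.

Lemma smooth_Binf_app (b : T -> Binf V W) (x y : T -> V) :
  smooth b -> smooth x -> smooth y -> smooth (fun t => b t (x t, y t)).
Proof.
move=> sb sx sy n U p pp; apply: (@eval_smooth R (V * V)%type W _ _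
  (fun u => (b (p u) : Cinf (V * V)%type W, (x (p u), y (p u))))).
by split; [exact: sb|split; [exact: sx|exact: sy]].
Qed.

End ExponentialLaw.

Section LinearMaps.
Variables (R : realType) (V W : diffVectType R).

Lemma LinfP (f : Linf V W) : linear f.
Proof. by apply/asboolP; exact: Linf_prop. Qed.

Lemma BinfP (b : Binf V W) :
  bilinear_for *:%R *:%R (fun x y => b (x, y)).
Proof. by apply/asboolP; exact: Binf_prop. Qed.

Lemma Linf_ext (f g : Linf V W) : (forall x, f x = g x) -> f = g.
(* One [val_inj] strips the linearity proof, the other the smoothness proof. *)
Proof. by move=> fg; do 2 apply: val_inj; exact: funext. Qed.

Lemma Binf_ext (b c : Binf V W) : (forall x y, b (x, y) = c (x, y)) -> b = c.
Proof. by move=> bc; do 2 apply: val_inj; apply: funext => -[]. Qed.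

Definition mkLinf (f : V -> W) (sf : smooth f) (lf : linear f) : Linf V W :=
  @MkLinf R V W (MkCinf (asboolT sf)) (asboolT lf).

Definition mkBinf (b : V * V -> W) (sb : smooth b)
    (lb : bilinear_for *:%R *:%R (fun x y => b (x, y))) : Binf V W :=
  @MkBinf R V W (MkCinf (asboolT sb)) (asboolT lb).

End LinearMaps.

Section Currying.
Variables (R : realType) (V W : diffVectType R).

Fact partial_smooth (b : Binf V W) x : smooth (fun y => b (x, y)).
Proof.
apply: (@smooth_Binf_app R V V W (fun=> b) (fun=> x) id) => //;
  exact: smooth_cst.
Qed.

Definition partial (b : Binf V W) x : Linf V W :=
  mkLinf (@partial_smooth b x) ((BinfP b).2 x).

Fact partial_map_smooth b : smooth (partial b).
Proof.
apply: Linf_smooth; apply: (@smooth_Binf_app R (V * V)%type V W (fun=> b) fst snd).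
- exact: smooth_cst.
- exact: fst_smooth.
- exact: snd_smooth.
Qed.

(** Operations on [Linf V W] are pointwise, so this is linearity of [b] in its first argument. *)
Fact partial_map_linear b : linear (partial b).
Proof. by move=> a x y; apply: Linf_ext => z; exact: (BinfP b).1. Qed.

Definition curry_Binf b : Linf V (Linf V W) :=
  mkLinf (@partial_map_smooth b) (@partial_map_linear b).

Fact uncurry_smooth (f : Linf V (Linf V W)) :
  smooth (fun z : V * V => f z.1 z.2).
Proof.
apply: (@smooth_Linf_app R (V * V)%type V W (fun z => f z.1) snd).
  exact: smooth_comp (@fst_smooth _ _ _) (CinfP f).
exact: snd_smooth.
Qed.

Fact uncurry_bilinear (f : Linf V (Linf V W)) :
  bilinear_for *:%R *:%R (fun x y => f x y).
(* The first slot uses linearity of [f] itself, the second that of the map [f x]. *)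
Proof. by split=> [y|x] a u v; rewrite LinfP. Qed.

Definition uncurry_Linf f : Binf V W :=
  mkBinf (@uncurry_smooth f) (@uncurry_bilinear f).

Lemma curry_Binf_linear : linear curry_Binf.
Proof. by move=> a b c; apply: Linf_ext => x; exact: Linf_ext. Qed.

Lemma curry_BinfK : cancel curry_Binf uncurry_Linf.
Proof. by move=> b; exact: Binf_ext. Qed.

(** Both sides have the same values by computation; extensionality is needed once per nested
    [Linf]. *)
Lemma uncurry_LinfK : cancel uncurry_Linf curry_Binf.
Proof. by move=> f; apply: Linf_ext => x; exact: Linf_ext. Qed.

Lemma curry_Binf_smooth : smooth curry_Binf.
Proof.
(* Uncurrying once per nested [Linf] leaves the evaluation of [b] at [(x, y)], on triples
   [((b, x), y)]. *)
apply: Linf_smooth; apply: Linf_smooth.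
apply: (@smooth_Binf_app R (Binf V W * V * V)%type V W
  (fun z => z.1.1) (fun z => z.1.2) snd).
- exact: smooth_comp (@fst_smooth _ _ _) (@fst_smooth _ _ _).
- exact: smooth_comp (@fst_smooth _ _ _) (@snd_smooth _ _ _).
- exact: snd_smooth.
Qed.

Lemma uncurry_Linf_smooth : smooth uncurry_Linf.
Proof.
pose T : diffeologicalType R := (Linf V (Linf V W) * (V * V))%type.
apply: Binf_smooth.
(* On triples [(f, (x, y))], the value [f x y] is an iterated evaluation: first [f] at [x], with
   value in [Linf V W], then the result at [y]. *)
apply: (@smooth_Linf_app R T V W (fun z => z.1 z.2.1) (fun z => z.2.2)).
- apply: (@smooth_Linf_app R T V (Linf V W) fst (fun z => z.2.1)).
    exact: fst_smooth.
  exact: smooth_comp (@snd_smooth _ _ _) (@fst_smooth _ _ _).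
- exact: smooth_comp (@snd_smooth _ _ _) (@snd_smooth _ _ _).
Qed.

End Currying.

Theorem theorem1p7 (R : realType) (V W : diffVectType R) :
  diffvect_diffeomorphic (Binf V W) (Linf V (Linf V W)).
Proof.
exists (@curry_Binf R V W), (@uncurry_Linf R V W); split.
- exact: curry_Binf_linear.
- exact: curry_BinfK.
- exact: uncurry_LinfK.
- exact: curry_Binf_smooth.
- exact: uncurry_Linf_smooth.
Qed.
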